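(* Let $L$ be a frame and $(P;e)$ an $L$-complete lattice. Define $f:(L^P;\tilde e)\to(L^P;\tilde e)$ by $f(S)=\downarrow\sqcup S$ for each $S\in L^P$. Then $f$ is monotone and there exists an $L$-order isomorphism between $(Fix(f);\tilde e)$ and $(P;e)$.
   Context: A frame is a complete lattice $L$ (with bottom $0$, top $1$) satisfying $a\wedge\bigvee S=\bigvee_{s\in S}(a\wedge s)$ for all $a\in L$, $S\subseteq L$; its relative pseudocomplement is $a\to b=\bigvee\{x\in L\mid a\wedge x\le b\}$. $L^P$ is the set of all maps $P\to L$. An $L$-ordered set is a pair $(P;e)$ with $P$ a set and $e:P\times P\to L$ a map such that for all $x,y,z\in P$: (E1) $e(x,x)=1$; (E2) $e(x,y)\wedge e(y,z)\le e(x,z)$; (E3) $e(x,y)=e(y,x)=1$ implies $x=y$. For $S\in L^P$, an element $x_0\in P$ is the join of $S$, written $x_0=\sqcup S$, if for all $x\in P$: $S(x)\le e(x,x_0)$ and $\bigwedge_{y\in P}(S(y)\to e(y,x))\le e(x_0,x)$. It is the meet, $x_0=\sqcap S$, if for all $x\in P$: $S(x)\le e(x_0,x)$ and $\bigwedge_{y\in P}(S(y)\to e(x,y))\le e(x,x_0)$. Joins and meets are unique when they exist. $(P;e)$ is an $L$-complete lattice if $\sqcup S$ and $\sqcap S$ exist for every $S\in L^P$. For $a\in P$, $\downarrow a\in L^P$ is the map $\downarrow a(x)=e(x,a)$. On $L^P$, $\tilde e(S,T)=\bigwedge_{x\in P}(S(x)\to T(x))$, which makes $(L^P;\tilde e)$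 an $L$-ordered set. $Fix(f)=\{S\in L^P\mid f(S)=S\}$ carries the restriction of $\tilde e$. A map $\varphi:(X;e_X)\to(Y;e_Y)$ between $L$-ordered sets is monotone if $e_X(x,y)\le e_Y(\varphi(x),\varphi(y))$ for all $x,y\in X$; a monotone map $\varphi$ is an $L$-order isomorphism if it is one-to-one, onto, and $e_X(x,y)=e_Y(\varphi(x),\varphi(y))$ for all $x,y\in X$. *)

(* Defs.v *)
From HB Require Import structures.
From mathcomp Require Import all_boot all_order.
From mathcomp Require Import mathcomp_extra boolp classical_sets.

Set Implicit Arguments.
Unset Strict Implicit.
Unset Printing Implicit Defensive.

Import Order.TTheory.
Local Open Scope classical_set_scope.
Local Open Scope order_scope.

HB.mixin Record isFrame d (L : Type) of Order.TBLattice d L := {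
  bigjoin : set L -> L;
  bigjoin_isLub : forall A : set L, isLub A (bigjoin A);
  meet_bigjoin : forall (a : L) (A : set L),
    Order.meet a (bigjoin A) = bigjoin [set Order.meet a s | s in A]
}.

#[short(type="frameType")]
HB.structure Definition Frame d := { L of Order.TBLattice d L & isFrame d L }.

Section FrameOperations.
Context {d : Order.disp_t} {L : frameType d}.

(* The infimum is the supremum of the lower bounds: see [bigmeet_lb] and
   [bigmeet_greatest]. *)
Definition bigmeet (A : set L) : L := bigjoin (lbound A).

Definition imp (a b : L) : L := bigjoin [set x | Order.meet a x <= b].

Lemma bigmeet_lb (A : set L) (a : L) : A a -> bigmeet A <= a.
Proof.
by move=> Aa; have [_] := bigjoin_isLub (lbound A); apply=> b; apply.
Qed.

Lemma bigmeet_greatest (A : set L) (b : L) :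
  (forall a, A a -> b <= a) -> b <= bigmeet A.
Proof. by move=> bA; have [+ _] := bigjoin_isLub (lbound A); apply. Qed.

Lemma le_imp (a b c : L) : (c <= imp a b) = (Order.meet a c <= b).
Proof.
apply/idP/idP => [cab|acb]; last first.
  by have [+ _] := bigjoin_isLub [set x | Order.meet a x <= b]; apply.
apply: (le_trans (leI2 (lexx a) cab)); rewrite /imp meet_bigjoin.
have [_] := bigjoin_isLub [set Order.meet a s | s in [set x | Order.meet a x <= b]].
by apply=> _ [x axb <-].
Qed.

End FrameOperations.

HB.mixin Record isLOrdered d (L : frameType d) (P : Type) := {
  lord : P -> P -> L;
  lord_refl : forall x : P, lord x x = \top;
  lord_trans : forall x y z : P, Order.meet (lord x y) (lord y z) <= lord x z;
  lord_anti : forall x y : P, lord x y = \top -> lord y x = \top -> x = y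
}.

#[short(type="lOrderedType")]
HB.structure Definition LOrdered d (L : frameType d) :=
  { P of isLOrdered d L P }.

(* [L^P]; a named copy of [P -> L], to carry the subsethood L-order. *)
Definition Lset d (L : frameType d) (P : Type) : Type := P -> L.

Section LsetOrder.
Context {d : Order.disp_t} {L : frameType d} {P : Type}.
Implicit Types S T U : Lset L P.

Definition subsethood S T : L := bigmeet (range (fun x => imp (S x) (T x))).

Lemma le_subsethood S T (a : L) :
  a <= subsethood S T <-> forall x, Order.meet (S x) a <= T x.
Proof.
split=> [aST x|aST].
  by rewrite -le_imp; apply: (le_trans aST); apply: bigmeet_lb; exists x.
by apply: bigmeet_greatest => _ [x _ <-]; rewrite le_imp.
Qed.

Lemma subsethood_refl S : subsethood S S = \top.
Proof. by apply/eqP; rewrite -le1x; apply/le_subsethood => x; rewrite meetx1. Qed.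

Lemma subsethood_trans S T U :
  Order.meet (subsethood S T) (subsethood T U) <= subsethood S U.
Proof.
apply/le_subsethood => x; rewrite meetA.
have /le_subsethood/(_ x) ST := lexx (subsethood S T).
have /le_subsethood/(_ x) TU := lexx (subsethood T U).
exact: le_trans (leI2 ST (lexx _)) TU.
Qed.

Lemma subsethood_anti S T :
  subsethood S T = \top -> subsethood T S = \top -> S = T.
Proof.
move=> ST TS; apply/funext => x; apply/le_anti/andP; split.
  by have/le_subsethood/(_ x) := lexx (subsethood S T); rewrite {1}ST meetx1.
by have/le_subsethood/(_ x) := lexx (subsethood T S); rewrite {1}TS meetx1.
Qed.

HB.instance Definition _ := isLOrdered.Build d L (Lset L P)
  subsethood_refl subsethood_trans subsethood_anti.

End LsetOrder.

Definition Fix (T : Type) (f : T -> T) : Type := {x : T | f x = x}.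

Section FixOrder.
Context {d : Order.disp_t} {L : frameType d} {Q : lOrderedType L}.
Variable f : Q -> Q.

Definition Fix_lord (x y : Fix f) : L := lord (sval x) (sval y).

Lemma Fix_lord_anti (x y : Fix f) :
  Fix_lord x y = \top -> Fix_lord y x = \top -> x = y.
Proof.
by case: x y => [x fx] [y fy] xy yx; apply: eq_exist; apply: lord_anti.
Qed.

HB.instance Definition _ := isLOrdered.Build d L (Fix f)
  (fun x => lord_refl (sval x))
  (fun x y z => lord_trans (sval x) (sval y) (sval z))
  Fix_lord_anti.

End FixOrder.

Section LOrderedTheory.
Context {d : Order.disp_t} {L : frameType d}.

Section LComplete.
Context {P : lOrderedType L}.
Implicit Types S : Lset L P.

Definition is_Ljoin S (x0 : P) : Prop := forall x : P,
  S x <= lord x x0 /\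
  bigmeet (range (fun y : P => imp (S y) (lord y x))) <= lord x0 x.

Definition is_Lmeet S (x0 : P) : Prop := forall x : P,
  S x <= lord x0 x /\
  bigmeet (range (fun y : P => imp (S y) (lord x y))) <= lord x x0.

Definition Ldown (a : P) : Lset L P := fun x => lord x a.

End LComplete.

Definition L_complete (P : lOrderedType L) : Prop := forall S : Lset L P,
  (exists x0 : P, is_Ljoin S x0) /\ (exists x0 : P, is_Lmeet S x0).

(* A join is unique by [lord_anti], so the choice made by [cid] is immaterial. *)
Definition Ljoin (P : lOrderedType L) (cP : L_complete P) (S : Lset L P) : P :=
  sval (cid (proj1 (cP S))).

Definition Lmonotone (X Y : lOrderedType L) (phi : X -> Y) : Prop :=
  forall x y : X, (lord x y : L) <= lord (phi x) (phi y).

Definition Lorder_iso (X Y : lOrderedType L) (phi : X -> Y) : Prop :=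
  [/\ Lmonotone phi,
      injective phi,
      forall y : Y, exists x : X, phi x = y &
      forall x y : X, lord x y = lord (phi x) (phi y) :> L].

End LOrderedTheory.

(* Main.v *)
(* The join is left adjoint to [Ldown], and [Ldown] is an order embedding by the
   Yoneda lemma, so [f] is the closure operator of a reflection: its fixed points
   are exactly the principal down-sets, and the join inverts [Ldown] on them. *)
Require Import Defs.
From mathcomp Require Import all_boot all_order.
From mathcomp Require Import boolp.

Import Order.TTheory.
Local Open Scope order_scope.

Section JoinAdjunction.
Context {d : Order.disp_t} {L : frameType d} {P : lOrderedType L}.

(** The meet in the second clause of [is_Ljoin] unfolds to [subsethood S (Ldown x)], giving one
    inequality; the other composes [S y <= lord y x0] with transitivity. *)
Lemma is_Ljoin_adjoint (S : Lset L P) (x0 x : P) :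
  is_Ljoin S x0 -> lord x0 x = subsethood S (Ldown x) :> L.
Proof.
move=> Sx0; apply/le_anti; rewrite (proj2 (Sx0 x)) andbT.
apply/le_subsethood => y.
exact: le_trans (leI2 (proj1 (Sx0 y)) (lexx _)) (lord_trans _ _ _).
Qed.

(** Yoneda: evaluate the inclusion at [x], where [Ldown x] takes the value [\top]; the converse is
    transitivity. *)
Lemma subsethood_Ldown (x y : P) :
  subsethood (Ldown x) (Ldown y) = lord x y :> L.
Proof.
apply/le_anti/andP; split; last by apply/le_subsethood => z; apply: lord_trans.
have /le_subsethood/(_ x) := lexx (subsethood (Ldown x) (Ldown y)).
by rewrite {1}/Ldown lord_refl meet1x.
Qed.

Lemma lord_Ljoin (cP : L_complete P) (S : Lset L P) (x : P) :
  lord (Ljoin cP S) x = subsethood S (Ldown x) :> L.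
Proof. by apply: is_Ljoin_adjoint; rewrite /Ljoin; case: cid. Qed.

Lemma Ljoin_Ldown (cP : L_complete P) (x : P) : Ljoin cP (Ldown x) = x.
Proof.
have eqj y : lord (Ljoin cP (Ldown x)) y = lord x y :> L.
  by rewrite lord_Ljoin subsethood_Ldown.
by apply: (@lord_anti _ L); [rewrite eqj | rewrite -eqj]; rewrite lord_refl.
Qed.

Lemma Ljoin_monotone (cP : L_complete P) : Lmonotone (Ljoin cP).
Proof.
move=> S T; rewrite lord_Ljoin.
apply: le_trans (subsethood_trans S T _).
(* Unit of the adjunction: [T] lies below [Ldown (Ljoin cP T)] to degree [\top]. *)
by rewrite -(lord_Ljoin cP T) lord_refl meetx1.
Qed.

End JoinAdjunction.

(** Injectivity is automatic: points with equal images are related to degree [\top] both ways, hence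
    equal by [lord_anti]. *)
Lemma Lorder_iso_intro (d : Order.disp_t) (L : frameType d)
    (X Y : lOrderedType L) (phi : X -> Y) :
  (forall x y : X, lord x y = lord (phi x) (phi y) :> L) ->
  (forall y : Y, exists x : X, phi x = y) -> Lorder_iso phi.
Proof.
move=> phiE phi_onto; split=> // x y; first by rewrite phiE.
by move=> eq_phi; apply: (@lord_anti _ L); rewrite phiE eq_phi lord_refl.
Qed.

Theorem theorem3p7 (d : Order.disp_t) (L : frameType d) (P : lOrderedType L)
    (cP : L_complete P) :
  let f : Lset L P -> Lset L P := fun S => Ldown (Ljoin cP S) in
  Lmonotone f /\
  exists phi : Fix f -> P, Lorder_iso phi.
Proof.
move=> f; split.
  by move=> S T; rewrite [leRHS]subsethood_Ldown; apply: Ljoin_monotone.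
exists (fun S => Ljoin cP (sval S)); apply: Lorder_iso_intro => [[S fS] [T fT]|x].
  (* Yoneda turns the order between the joins into the one between [f S] and [f T], which are [S]
     and [T] themselves. *)
  by rewrite -[RHS]subsethood_Ldown /= -/(f S) -/(f T) fS fT.
have fx : f (Ldown x) = Ldown x by rewrite /f Ljoin_Ldown.
by exists (exist (fun S => f S = S) (Ldown x) fx); apply: Ljoin_Ldown.
Qed.
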